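(* Let $\mathbf w=(w_1,\ldots,w_L)^\top$ be a positive probability vector. Then $$\max_{\boldsymbol\gamma=(\gamma_1,\ldots,\gamma_L)^\top>\mathbf 0,\ \rho(\mathrm{diag}(\boldsymbol\gamma)\tilde F)\le1}\ \sum_{l=1}^L w_l\log\gamma_l=\sum_{l=1}^L w_l\log\gamma_l^\star,$$ where $\boldsymbol\gamma^\star=(\gamma_1^\star,\ldots,\gamma_L^\star)^\top>\mathbf 0$ is the unique positive vector satisfying the following conditions: with $A^\star=\mathrm{diag}(\boldsymbol\gamma^\star)\tilde F$, one has $\rho(A^\star)=1$ and $\mathbf x(A^\star)\circ\mathbf y(A^\star)=\mathbf w$.
   Context: $F=[f_{ij}]\in\mathbb R^{L\times L}$ is a fixed matrix with zero diagonal entries and positive off-diagonal entries, and $\mathbf v,\bar{\mathbf p}\in\mathbb R^L$ are fixed vectors with all entries positive. The positive matrix $\tilde F$ is $\tilde F=F+\mathrm{diag}(v_1/\bar p_1,\ldots,v_L/\bar p_L)$. For an irreducible nonnegative matrix $A$, $\rho(A)$ is its spectral radius (Perron-Frobenius eigenvalue), and $\mathbf x(A),\mathbf y(A)>\mathbf 0$ are right and left Perron eigenvectors ($A\mathbf x=\rho(A)\mathbf x$, $\mathbf y^\top A=\rho(A)\mathbf y^\top$) normalized so that $\mathbf x(A)\circ\mathbf y(A)$ is a probability vector; $\circ$ is the entrywise product. The vector $\mathbf x(A)\circ\mathbf y(A)$ is then uniquely determined. A probability vector is a nonnegative vector with entries summing to $1$; $\boldsymbol\gamma>\mathbf 0$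 means all entries are positive. *)

(* Defs.v *)
(* MathComp-Analysis over an arbitrary [R : realType]; complex numbers are
   [R[i]] from mathcomp-real-closed. *)
From HB Require Import structures.
From mathcomp Require Import all_boot all_order all_algebra.
From mathcomp Require Import all_classical all_reals all_analysis.
From mathcomp.real_closed Require Import complex.

Set Implicit Arguments.
Unset Strict Implicit.
Unset Printing Implicit Defensive.

Import Order.TTheory GRing.Theory Num.Theory.

Local Open Scope classical_set_scope.
Local Open Scope ring_scope.

Section Definitions.
Variable R : realType.

Definition positive_vec (n : nat) (u : 'cV[R]_n) : Prop :=
  forall i, 0 < u i 0.

Definition probability_vec (n : nat) (u : 'cV[R]_n) : Prop :=
  (forall i, 0 <= u i 0) /\ \sum_i u i 0 = 1.

Definition diag (n : nat) (u : 'cV[R]_n) : 'M[R]_n := diag_mx u^T.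

Definition entrywise_mul (n : nat) (x y : 'cV[R]_n) : 'cV[R]_n :=
  \col_i (x i 0 * y i 0).

(* Largest modulus of a complex eigenvalue.  For [n > 0] the set of moduli is
   finite and nonempty, so [sup] is a maximum; for [n = 0] it is [sup set0]. *)
Definition spectral_radius (n : nat) (A : 'M[R]_n) : R :=
  sup [set ComplexField.Normc.normc z | z in
    [set z : R[i] | eigenvalue (map_mx (real_complex R) A) z]].

Definition right_perron (n : nat) (A : 'M[R]_n) (x : 'cV[R]_n) : Prop :=
  positive_vec x /\ A *m x = spectral_radius A *: x.

Definition left_perron (n : nat) (A : 'M[R]_n) (y : 'cV[R]_n) : Prop :=
  positive_vec y /\ y^T *m A = spectral_radius A *: y^T.

(* [x] and [y] are only determined up to [(c x, y / c)], but their entrywise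
   product is unique for irreducible nonnegative [A]; hence "x(A) o y(A) = u"
   is the relation [perron_product A u]. *)
Definition perron_product (n : nat) (A : 'M[R]_n) (u : 'cV[R]_n) : Prop :=
  exists x y : 'cV[R]_n,
    [/\ right_perron A x, left_perron A y,
        probability_vec (entrywise_mul x y) & entrywise_mul x y = u].

Definition Ftilde (n : nat) (F : 'M[R]_n) (v pbar : 'cV[R]_n) : 'M[R]_n :=
  F + diag (\col_l (v l 0 / pbar l 0)).

Definition log_objective (n : nat) (w gamma : 'cV[R]_n) : R :=
  \sum_l w l 0 * ln (gamma l 0).

Definition feasible (n : nat) (B : 'M[R]_n) : set 'cV[R]_n :=
  [set gamma | positive_vec gamma /\ spectral_radius (diag gamma *m B) <= 1].

Definition is_maximum (S : set R) (m : R) : Prop := S m /\ ubound S m.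

End Definitions.

(* Main.v *)
Require Import Defs.
From HB Require Import structures.
From mathcomp Require Import all_boot all_order all_algebra.
From mathcomp Require Import all_classical all_reals all_analysis.
From mathcomp.real_closed Require Import complex.
From mathcomp Require Import ring lra.

Set Implicit Arguments.
Unset Strict Implicit.
Unset Printing Implicit Defensive.

Import Order.TTheory GRing.Theory Num.Theory.

Local Open Scope classical_set_scope.
Local Open Scope ring_scope.

(** Write B for the positive matrix and phi (x) for the value of the objective
    sum_i w_i ln gamma_i at gamma = x / (B x), with x > 0 and the quotient
    taken entrywise; phi is constant on rays.

    The constrained problem is the unconstrained maximization of phi.  A vector
    gamma = x / (B x) satisfies diag(gamma) B x = x, so its spectral radius
    is 1.  Conversely, if rho (diag(gamma) B) <= 1 and x is a Perron vector of
    diag(gamma) B, then gamma_i (B x)_i = rho x_i <= x_i, hence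
    gamma <= x / (B x) and the objective at gamma is at most phi (x)
    ([feasible_le_gain]).

    Let S_j (x) be the partial derivative of sum_i w_i ln (B x)_i in x_j; phi
    is stationary at x exactly when x_j S_j (x) = w_j for all j.  As
    y = w / x is then a left Perron vector of diag(x / B x) B, stationary
    points are the same thing as solutions of rho = 1 and x o y = w
    ([gain_perron_solution], [perron_solution_gain]).

    What remains is that phi has a stationary point, that stationary points
    are maximizers, and that they all give the same gamma.  The last two hold
    because phi is concave in ln x; here they follow from Jensen's inequality
    for ln, applied row by row to the stochastic matrix
    P_ij = B_ij x_j / (B x)_i, for which stationarity of x says that w is an
    invariant distribution ([stationary_max], [stationary_max_eq]).

    For existence, differentiation is replaced by the
    minorization-maximization step x |-> w / S (x): by Jensen it never
    decreases phi, and it leaves phi unchanged only at stationary points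
    ([ascent_step_stationary]).  The step maps every positive vector, up to
    scaling, into a fixed box [e, 1]^n, so a maximizer of phi over that compact
    box cannot be improved by it ([exists_nondescending]).  The same
    compactness argument, with the step x |-> A x and the function
    max_i (A x)_i / x_i, produces the Perron vector of a positive matrix A
    ([exists_perron]). *)

Section PerronProducts.
Import numFieldNormedType.Exports ComplexField.Normc.
Variable R : realType.

(** * Inequalities over finite sums *)

Lemma finite_pos_lb (I : finType) (f : I -> R) :
  (forall i, 0 < f i) -> exists2 e, 0 < e & forall i, e <= f i.
Proof.
move=> f_gt0; exists (\big[Num.min/1]_i f i).
  by elim/big_ind: _ => // x y x0 y0; rewrite lt_min x0.
by move=> i; rewrite (bigD1 i) //= ge_min lexx.
Qed.

Lemma sumr_gt0 (I : finType) (f : I -> R) (i0 : I) :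
  (forall i, 0 < f i) -> 0 < \sum_i f i.
Proof.
move=> f_gt0; rewrite (bigD1 i0) //= ltr_pwDl //.
by apply: sumr_ge0 => i _; exact: ltW.
Qed.

Lemma sum1_inhabitant (I : finType) (p : I -> R) : \sum_i p i = 1 -> I.
Proof.
move=> p1; case: (pickP (@predT I)) => [i //|p0].
by move: p1; rewrite big_pred0 // => /esym/eqP; rewrite oner_eq0.
Qed.

Lemma ln_le_subr1 (t : R) : 0 < t -> ln t <= t - 1.
Proof.
by move=> t0; have := expR_ge1Dx (ln t); rewrite lnK ?posrE // -lerBrDl.
Qed.

Lemma ln_eq_subr1 (t : R) : 0 < t -> ln t = t - 1 -> t = 1.
Proof.
move=> t0 lnt; apply/eqP; rewrite -subr_eq0 -lnt; apply/negPn/negP.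
by move=> /expR_gt1Dx; rewrite lnK ?posrE // {1}lnt addrC subrK ltxx.
Qed.

Section Jensen.
Variables (I : finType) (p u : I -> R).
Hypotheses (p_gt0 : forall i, 0 < p i) (p_sum1 : \sum_i p i = 1).
Hypothesis u_gt0 : forall i, 0 < u i.

Let s := \sum_i p i * u i.

Let s_gt0 : 0 < s.
Proof. by apply: (sumr_gt0 (sum1_inhabitant p_sum1)) => i; exact: mulr_gt0. Qed.

(* These terms add up to the Jensen deficit, so equality kills each of them. *)
Let gap i := p i * (u i / s - 1 - ln (u i / s)).

Let gap_ge0 i : 0 <= gap i.
Proof.
by rewrite mulr_ge0 ?(ltW (p_gt0 i)) // subr_ge0 ln_le_subr1 // divr_gt0.
Qed.

Let sum_gap : \sum_i gap i = ln s - \sum_i p i * ln (u i).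
Proof.
transitivity (\sum_i (p i * u i / s - p i - p i * ln (u i) + p i * ln s)).
  apply: eq_bigr => i _; rewrite /gap ln_div ?posrE //.
  by rewrite !mulrBr mulr1 mulrA opprB addrA addrAC.
rewrite big_split /= -mulr_suml p_sum1 mul1r !sumrB p_sum1 -mulr_suml.
by rewrite divff ?gt_eqF // subrr sub0r addrC.
Qed.

Lemma jensen_ln : \sum_i p i * ln (u i) <= ln (\sum_i p i * u i).
Proof. by rewrite -subr_ge0 -sum_gap sumr_ge0. Qed.

Lemma jensen_ln_eq : \sum_i p i * ln (u i) = ln (\sum_i p i * u i) ->
  forall i, u i = \sum_i p i * u i.
Proof.
move=> eq_ln i; have /eqP : \sum_i gap i = 0 by rewrite sum_gap -/s eq_ln subrr.
rewrite psumr_eq0 // => /allP/(_ i (mem_index_enum _))/eqP/eqP.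
rewrite mulf_eq0 gt_eqF //= subr_eq0 => /eqP/esym/ln_eq_subr1.
by move=> /(_ (divr_gt0 (u_gt0 i) s_gt0)) /divr1_eq.
Qed.

End Jensen.

Lemma mulmx_gt0 n (A : 'M[R]_n) (x : 'cV[R]_n) :
  (forall i j, 0 < A i j) -> positive_vec x -> positive_vec (A *m x).
Proof.
by move=> A0 x0 i; rewrite mxE; apply: (sumr_gt0 i) => j; exact: mulr_gt0.
Qed.

(** * Stationary points of the reduced objective *)

Section Gain.
Variables (n : nat) (B : 'M[R]_n) (w : 'cV[R]_n).
Hypothesis B_gt0 : forall i j, 0 < B i j.
Hypotheses (w_gt0 : positive_vec w) (w_sum1 : \sum_i w i 0 = 1).

(** The only positive a for which [x] is fixed by [diag a *m B]. *)
Definition gain (x : 'cV[R]_n) : 'cV[R]_n := \col_i (x i 0 / (B *m x) i 0).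

(** The gradient at [x] of [x |-> \sum_i w i 0 * ln ((B *m x) i 0)]. *)
Definition ln_grad (x : 'cV[R]_n) : 'cV[R]_n :=
  \col_j \sum_i w i 0 * B i j / (B *m x) i 0.

Let Bx_gt0 x : positive_vec x -> positive_vec (B *m x).
Proof. exact: mulmx_gt0. Qed.

Lemma ln_grad_gt0 x : positive_vec x -> positive_vec (ln_grad x).
Proof.
move=> x0 j; rewrite mxE; apply: (sumr_gt0 j) => i.
by rewrite divr_gt0 ?mulr_gt0 //; exact: Bx_gt0.
Qed.

(** Exchanging the sums over rows and columns; for [z := x] and weights of sum
    one this is Euler's identity, and both sides are 1. *)
Lemma sum_ln_grad (x z : 'cV[R]_n) :
  \sum_j z j 0 * ln_grad x j 0 = \sum_i w i 0 * ((B *m z) i 0 / (B *m x) i 0).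
Proof.
under eq_bigr do rewrite mxE mulr_sumr.
rewrite exchange_big; apply: eq_bigr => i _ /=.
rewrite [(B *m z) i 0]mxE mulr_suml mulr_sumr; apply: eq_bigr => j _.
by rewrite mulrC -!mulrA; congr (_ * (_ * _)); rewrite mulrC.
Qed.

Lemma log_objective_gainB x z : positive_vec x -> positive_vec z ->
  log_objective w (gain z) - log_objective w (gain x) =
  \sum_i w i 0 * ln (z i 0 / x i 0)
  - \sum_i w i 0 * ln ((B *m z) i 0 / (B *m x) i 0).
Proof.
move=> x0 z0; rewrite /log_objective -!sumrB; apply: eq_bigr => i _.
rewrite -!mulrBr !mxE !ln_div ?posrE //; try exact: Bx_gt0.
- congr (_ * _); rewrite !opprB addrACA [RHS]addrACA; congr (_ + _).
  by rewrite addrC.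
all: by have := Bx_gt0 x0 i; have := Bx_gt0 z0 i; rewrite !mxE.
Qed.

Definition stationary (x : 'cV[R]_n) :=
  positive_vec x /\ forall j, x j 0 * ln_grad x j 0 = w j 0.

Section Stationary.
Variables x z : 'cV[R]_n.
Hypotheses (x_st : stationary x) (z_gt0 : positive_vec z).

Let x_gt0 : positive_vec x. Proof. by case: x_st. Qed.

(* The rows of P average the growth factors u_j = z_j / x_j into the growth
   factors of B x, and w is invariant under P. *)
Let P i j := B i j * x j 0 / (B *m x) i 0.
Let u j := z j 0 / x j 0.

Let P_gt0 i j : 0 < P i j.
Proof. by rewrite divr_gt0 ?mulr_gt0 //; exact: Bx_gt0. Qed.

Let P_sum1 i : \sum_j P i j = 1.
Proof.
rewrite -mulr_suml.
have -> : \sum_j B i j * x j 0 = (B *m x) i 0 by rewrite mxE.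
by rewrite divff // gt_eqF //; exact: Bx_gt0.
Qed.

Let wP j : \sum_i w i 0 * P i j = w j 0.
Proof.
case: x_st => _ /(_ j) <-; rewrite mxE mulr_sumr; apply: eq_bigr => i _.
by rewrite /P !mulrA; congr (_ / _); rewrite mulrC mulrA.
Qed.

Let Pu i : \sum_j P i j * u j = (B *m z) i 0 / (B *m x) i 0.
Proof.
rewrite [(B *m z) i 0]mxE mulr_suml; apply: eq_bigr => j _.
rewrite /P /u mulrAC; congr (_ / _); rewrite -mulrA; congr (_ * _).
by rewrite mulrC divfK // gt_eqF.
Qed.

Let u_gt0 j : 0 < u j. Proof. exact: divr_gt0. Qed.

Let gap i := w i 0 * (ln (\sum_j P i j * u j) - \sum_j P i j * ln (u j)).

Let gap_ge0 i : 0 <= gap i.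
Proof.
by apply: mulr_ge0; [exact: ltW|rewrite subr_ge0; exact: jensen_ln].
Qed.

Let objB : log_objective w (gain x) - log_objective w (gain z) = \sum_i gap i.
Proof.
rewrite -[LHS]opprB log_objective_gainB // opprB.
have -> : \sum_i w i 0 * ln (z i 0 / x i 0) =
          \sum_i w i 0 * \sum_j P i j * ln (u j).
  under [RHS]eq_bigr do rewrite mulr_sumr.
  rewrite exchange_big; apply: eq_bigr => j _ /=.
  by under [RHS]eq_bigr do rewrite mulrA; rewrite -mulr_suml wP.
by rewrite -sumrB; apply: eq_bigr => i _; rewrite /gap Pu mulrBr.
Qed.

(** Jensen in row i bounds [ln ((B z)_i / (B x)_i)] below by the P-average of
    the logarithms of the ratios [z_j / x_j]; invariance of [w] under P turns
    the sum of these bounds into [\sum_j w_j ln (z_j / x_j)]. *)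
Lemma stationary_max : log_objective w (gain z) <= log_objective w (gain x).
Proof. by rewrite -subr_ge0 objB sumr_ge0. Qed.

(** Equality forces equality in every row, whence [z_i / x_i] equals
    [(B z)_i / (B x)_i] (and [z] is in fact a multiple of [x]). *)
Lemma stationary_max_eq :
  log_objective w (gain z) = log_objective w (gain x) -> gain z = gain x.
Proof.
move=> eq_obj; apply/matrixP => i k; rewrite (ord1 k).
have /eqP : \sum_i gap i = 0 by rewrite -objB eq_obj subrr.
rewrite psumr_eq0 // => /allP/(_ i (mem_index_enum _))/eqP/eqP.
rewrite mulf_eq0 gt_eqF //= subr_eq0 => /eqP/esym.
move=> eq_ln; have := jensen_ln_eq (P_gt0 i) (P_sum1 i) u_gt0 eq_ln i.
rewrite Pu {1}/u => uE.
rewrite [LHS]mxE [RHS]mxE.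
have xN := lt0r_neq0 (x_gt0 i); have BN := lt0r_neq0 (Bx_gt0 x_gt0 i).
have BzN := lt0r_neq0 (Bx_gt0 z_gt0 i).
rewrite -[z i 0](divfK xN) uE mulrAC [_ * x i 0]mulrC; field.
by rewrite BN.
Qed.

End Stationary.

(** A maximizer in [z] of the minorant
    [\sum_j w_j ln z_j - ln (\sum_j z_j S_j)], with [S := ln_grad x], of the
    objective at [gain z] (up to a constant); both agree at [z := x]. *)
Definition ascent_step (x : 'cV[R]_n) : 'cV[R]_n :=
  \col_j (w j 0 / ln_grad x j 0).

Lemma ascent_step_gt0 x : positive_vec x -> positive_vec (ascent_step x).
Proof. by move=> x0 j; rewrite mxE divr_gt0 //; exact: ln_grad_gt0. Qed.

Section Ascent.
Variable x : 'cV[R]_n.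
Hypothesis x_gt0 : positive_vec x.

Let g := ascent_step x.
Let g_gt0 : positive_vec g. Proof. exact: ascent_step_gt0. Qed.
Let S_gt0 := ln_grad_gt0 x_gt0.
Let u j := x j 0 * ln_grad x j 0 / w j 0.
Let u_gt0 j : 0 < u j.
Proof. by rewrite divr_gt0 ?mulr_gt0 //; exact: S_gt0. Qed.

Let sum_wu : \sum_j w j 0 * u j = 1.
Proof.
transitivity (\sum_j x j 0 * ln_grad x j 0).
  by apply: eq_bigr => j _; rewrite /u mulrC divfK // gt_eqF.
rewrite sum_ln_grad -w_sum1; apply: eq_bigr => i _.
by rewrite divff ?mulr1 // gt_eqF //; exact: Bx_gt0.
Qed.

Let sum_ratio : \sum_i w i 0 * ((B *m g) i 0 / (B *m x) i 0) = 1.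
Proof.
rewrite -sum_ln_grad -w_sum1; apply: eq_bigr => j _.
by rewrite mxE divfK // gt_eqF //; exact: S_gt0.
Qed.

Let ratio_le0 : \sum_i w i 0 * ln ((B *m g) i 0 / (B *m x) i 0) <= 0.
Proof.
have ratio_gt0 i : 0 < (B *m g) i 0 / (B *m x) i 0.
  by apply: divr_gt0; exact: Bx_gt0.
by have := jensen_ln w_gt0 w_sum1 ratio_gt0; rewrite sum_ratio ln1.
Qed.

Let objB : log_objective w (gain g) - log_objective w (gain x) =
  - \sum_j w j 0 * ln (u j)
  - \sum_i w i 0 * ln ((B *m g) i 0 / (B *m x) i 0).
Proof.
rewrite log_objective_gainB //; congr (_ - _); rewrite -sumrN.
apply: eq_bigr => j _; have -> : g j 0 / x j 0 = (u j)^-1.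
  by rewrite mxE -mulrA -invfM mulrC [_ * x j 0]mulrC /u invf_div mulrC.
by rewrite lnV ?posrE // mulrN.
Qed.

(** The increase of the objective is at least the relative entropy of [w] with
    respect to the probability vector [x_j S_j], which vanishes only when the
    two coincide. *)
Lemma ascent_step_stationary :
  log_objective w (gain g) <= log_objective w (gain x) -> stationary x.
Proof.
move=> le_obj; split=> // j.
have le0 := jensen_ln w_gt0 w_sum1 u_gt0; rewrite sum_wu ln1 in le0.
have eq0 : \sum_j w j 0 * ln (u j) = ln (\sum_j w j 0 * u j).
  rewrite sum_wu ln1; move: le_obj; rewrite -subr_le0 objB => h.
  by move: ratio_le0 le0 h; set a := \sum_i _; set b := \sum_i _; lra.
have := jensen_ln_eq w_gt0 w_sum1 u_gt0 eq0 j; rewrite sum_wu.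
by move/divr1_eq.
Qed.

End Ascent.

(** The components of [ln_grad x] are comparable uniformly in [x], since the
    entries of each row of [B] are; so the image of the step lies in a closed
    cone inside the positive orthant. *)
Lemma ascent_step_thick : exists2 e, 0 < e & forall x, positive_vec x ->
  forall j, e * \sum_k ascent_step x k 0 <= ascent_step x j 0.
Proof.
have [|e e0 eP] := @finite_pos_lb (prod 'I_n (prod 'I_n 'I_n))
    (fun t => w t.2.1 0 * B t.1 t.2.2 / B t.1 t.2.1).
  by move=> t; rewrite divr_gt0 ?mulr_gt0.
exists e => // x x0 j.
have le_S k : e * ln_grad x j 0 <= w j 0 * ln_grad x k 0.
  rewrite !mxE !mulr_sumr; apply: ler_sum => i _.
  have := eP (i, (j, k)); rewrite /= ler_pdivlMr // => le_e.
  rewrite !mulrA ler_pM2r ?invr_gt0; last exact: Bx_gt0.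
  by rewrite mulrAC [leRHS]mulrAC ler_wpM2r // ltW.
rewrite mulr_sumr; have Sj := ln_grad_gt0 x0 j.
rewrite -[leRHS]mul1r -w_sum1 mulr_suml; apply: ler_sum => k _.
have Sk := ln_grad_gt0 x0 k; rewrite mxE [ascent_step x j 0]mxE mulrCA.
rewrite ler_pM2l // ler_pdivrMr // mulrAC ler_pdivlMr //.
Qed.

End Gain.

(** * Existence by compactness *)

Lemma trmx_continuous (m p : nat) :
  continuous (fun r : 'M[R]_(m, p) => r^T).
Proof.
move=> r A [P Pr PA]; exists (fun i j => P j i) => [i j|s Ps].
  by have := Pr j i; rewrite mxE.
by apply: PA => i j; rewrite mxE; exact: Ps.
Qed.

Section Descent.
Variables (n : nat) (f : 'cV[R]_n -> R) (g : 'cV[R]_n -> 'cV[R]_n) (e : R).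
Hypothesis e_gt0 : 0 < e.
Hypothesis f_cont : forall x : 'cV[R]_n,
  positive_vec x -> {for x, continuous f}.
Hypothesis f_homog : forall a (x : 'cV[R]_n),
  0 < a -> positive_vec x -> f (a *: x) = f x.
Hypothesis g_gt0 : forall x, positive_vec x -> positive_vec (g x).
Hypothesis g_thick : forall x, positive_vec x ->
  forall i, e * \sum_k g x k 0 <= g x i 0.

(** A minimizer of [f] over the box [[e, 1]^n] will do: after division by the
    sum of its entries, any value of [g] lies in that box. *)
Lemma exists_nondescending :
  exists2 c, positive_vec c & f c <= f (g c).
Proof.
case: (posnP n) => [n0|n_gt0].
  exists 0; first by case=> i; rewrite n0.
  have -> // : g 0 = 0.
  by apply/matrixP; case=> i i_lt; have := i_lt; rewrite {1}n0.
pose i0 := Ordinal n_gt0.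
have sum_gt0 (x : 'cV[R]_n) : positive_vec x -> 0 < \sum_k x k 0.
  by move=> x0; exact: (sumr_gt0 i0).
have step_box (x : 'cV[R]_n) : positive_vec x -> forall i,
    e <= ((\sum_k g x k 0)^-1 *: g x) i 0 <= 1.
  move=> x0 i; rewrite mxE mulrC; have s0 := sum_gt0 _ (g_gt0 x0).
  rewrite ler_pdivlMr // ler_pdivrMr // mul1r g_thick //=.
  by rewrite (bigD1 i) //= lerDl sumr_ge0 // => k _; exact/ltW/g_gt0.
pose K : set 'rV[R]_n := [set v | forall i, `[e, 1]%classic (v ord0 i)].
have K_pos v : K v -> positive_vec v^T.
  move=> Kv i; rewrite mxE; have := Kv i.
  by rewrite /= in_itv => /andP[/(lt_le_trans e_gt0)].
have box_K (x : 'cV[R]_n) : (forall i, e <= x i 0 <= 1) -> K x^T.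
  by move=> xP i; rewrite /= mxE in_itv /= xP.
have one_pos : positive_vec (const_mx 1 : 'cV[R]_n) by move=> i; rewrite mxE.
have K0 : K !=set0 by eexists; exact: (box_K _ (step_box _ one_pos)).
have cK : compact K.
  apply: (@rV_compact _ n (fun=> `[e, 1]%classic)) => i.
  exact: segment_compact.
have fK : {within K, continuous (f \o trmx)}.
  apply: continuous_in_subspaceT => v /set_mem /K_pos v0.
  by apply: continuous_comp; [exact: trmx_continuous|exact: f_cont].
have [v /set_mem /K_pos v0 vmin] := EVT_min_rV K0 cK fK.
exists v^T => //; have := vmin _ (mem_set (box_K _ (step_box _ v0))).
by rewrite /= trmxK f_homog ?invr_gt0 ?sum_gt0 //; exact: g_gt0.
Qed.

End Descent.

Lemma mulmx_continuous n (A : 'M[R]_n) (i : 'I_n) :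
  continuous (fun x : 'cV[R]_n => (A *m x) i 0).
Proof.
have -> : (fun x : 'cV[R]_n => (A *m x) i 0) =
          (fun x : 'cV[R]_n => \sum_j A i j * x j 0).
  by apply/funext => x; rewrite mxE.
move=> x; apply: cvg_big => [||j _].
- exact: add_continuous.
- exact: nbhs_filter.
apply: (@continuousM _ _ (fun=> A i j) (fun y : 'cV[R]_n => y j 0)).
  exact: cst_continuous.
exact: coord_continuous.
Qed.

Lemma ratio_continuous n (A : 'M[R]_n) (x : 'cV[R]_n) (i : 'I_n) :
  0 < x i 0 ->
  {for x, continuous (fun y : 'cV[R]_n => (A *m y) i 0 / y i 0)}.
Proof.
move=> x0; apply: continuousM; first exact: mulmx_continuous.
by apply: continuousV; [rewrite gt_eqF|exact: coord_continuous].
Qed.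

Lemma exists_stationary n (B : 'M[R]_n) (w : 'cV[R]_n) :
  (forall i j, 0 < B i j) -> positive_vec w -> \sum_i w i 0 = 1 ->
  exists x, stationary B w x.
Proof.
move=> B0 w0 w1; have [e e0 eP] := ascent_step_thick B0 w0 w1.
(* Continuity is transparent in this form of minus the objective at [gain B x],
   a combination of the ratios handled by [ratio_continuous]. *)
pose f (x : 'cV[R]_n) := \sum_i w i 0 * ln ((B *m x) i 0 / x i 0).
have fE x : positive_vec x -> f x = - log_objective w (gain B x).
  move=> x0; rewrite /f /log_objective -sumrN; apply: eq_bigr => i _.
  have Bx0 := mulmx_gt0 B0 x0 i.
  by rewrite -invf_div lnV ?posrE ?divr_gt0 // mulrN [gain B x i 0]mxE.
have [||||x x0] := @exists_nondescending n f (ascent_step B w) e e0.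
- move=> x x0; apply: cvg_big => [||i _].
  + exact: add_continuous.
  + exact: nbhs_filter.
  apply: (@continuousM _ _ (fun=> w i 0)
    (fun y : 'cV[R]_n => ln ((B *m y) i 0 / y i 0))).
    exact: cst_continuous.
  apply: (@continuous_comp _ _ _ (fun y : 'cV_n => (B *m y) i 0 / y i 0) (@ln R)).
    exact: ratio_continuous.
  by apply: continuous_ln; rewrite divr_gt0 //; exact: mulmx_gt0.
- move=> a x a0 x0; apply: eq_bigr => i _; rewrite -scalemxAr !mxE.
  by rewrite -mulf_div divff ?mul1r // gt_eqF.
- by move=> x x0; exact: ascent_step_gt0.
- exact: eP.
rewrite !fE //; last exact: ascent_step_gt0.
rewrite lerN2 => le_obj; exists x; exact: ascent_step_stationary.
Qed.

(** The value of [f x := max_i (A x)_i / x_i] is the least l with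
    [A x <= l x]. If a point where [A] does not lower [f] were not an
    eigenvector, applying the positive matrix [A] to [f x *: x - A x], which is
    nonnegative and nonzero, would give [A (A x) < f x *: A x] in all
    entries. *)
Lemma exists_perron n (A : 'M[R]_n) : (forall i j, 0 < A i j) ->
  exists2 x, positive_vec x & exists l, A *m x = l *: x.
Proof.
move=> A0.
have [|e e0 eP] := @finite_pos_lb (prod 'I_n 'I_n)
    (fun t => A t.1 t.2 / \sum_k A k t.2).
  by move=> t; rewrite divr_gt0 //; apply: (sumr_gt0 t.1).
pose f (x : 'cV[R]_n) := \big[Num.max/0]_i ((A *m x) i 0 / x i 0).
have [||||x x0 le_f] := @exists_nondescending n f (mulmx A) e e0.
- move=> x x0; apply: cvg_big => [||i _].
  + exact: max_continuous.
  + exact: nbhs_filter.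
  exact: ratio_continuous.
- move=> a x a0 x0; apply: eq_bigr => i _; rewrite -scalemxAr !mxE.
  by rewrite -mulf_div divff ?mul1r // gt_eqF.
- by move=> x; exact: mulmx_gt0.
- move=> x x0 i; under eq_bigr do rewrite mxE.
  rewrite exchange_big mxE mulr_sumr; apply: ler_sum => j _ /=.
  rewrite -mulr_suml mulrA ler_pM2r // -ler_pdivlMr; first exact: (eP (i, j)).
  exact: (sumr_gt0 i).
exists x => //; exists (f x).
have le_Ax i : (A *m x) i 0 <= (f x *: x) i 0.
  rewrite [leRHS]mxE -ler_pdivrMr //.
  exact: (le_bigmax _ (fun i => (A *m x) i 0 / x i 0)).
apply/eqP/negPn/negP => neq.
have [i lt_i] : exists i, (A *m x) i 0 < (f x *: x) i 0.
  apply/not_existsP => ge_i; move/eqP: neq; apply.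
  apply/matrixP => i k; rewrite (ord1 k); apply/le_anti; rewrite le_Ax /=.
  by rewrite leNgt; apply/negP; exact: ge_i.
have fx0 : 0 < f x.
  have := lt_trans (mulmx_gt0 A0 x0 i) lt_i.
  by rewrite mxE pmulr_lgt0.
move: le_f; apply/negP; rewrite -ltNge.
apply: bigmax_lt => // k _.
rewrite ltr_pdivrMr; last exact: mulmx_gt0.
have -> : f x * (A *m x) k 0 = (A *m (f x *: x)) k 0.
  by rewrite -scalemxAr [RHS]mxE.
rewrite [ltLHS]mxE [ltRHS]mxE (bigD1 i) //= [ltRHS](bigD1 i) //=.
apply: ltr_leD; first by rewrite ltr_pM2l.
by apply: ler_sum => j _; rewrite ler_pM2l.
Qed.

(** * Perron vectors and the spectral radius *)

Lemma normc_real (a : R) : normc (real_complex R a) = `|a|.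
Proof. by rewrite /= expr0n addr0 sqrtr_sqr. Qed.

Lemma normc_sum (I : finType) (z : I -> R[i]) :
  normc (\sum_i z i) <= \sum_i normc (z i).
Proof.
elim/big_ind2: _ => [|x1 x2 y1 y2 le1 le2|//]; first by rewrite normc0.
by apply: le_trans (lerD le1 le2); exact: le_normcD.
Qed.

Lemma normc_ge0 (z : R[i]) : 0 <= normc z.
Proof. by case: z => a b; exact: sqrtr_ge0. Qed.

Lemma right_eigenvalue (K : fieldType) n (A : 'M[K]_n) (x : 'cV[K]_n) l :
  x != 0 -> A *m x = l *: x -> eigenvalue A l.
Proof.
move=> x_neq0 Ax; rewrite /eigenvalue /eigenspace kermx_eq0 row_free_unit.
apply: contra x_neq0 => A_unit; rewrite -(mulKmx A_unit x).
by rewrite mulmxBl Ax mul_scalar_mx subrr mulmx0.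
Qed.

(** Pairing [|z| |v| <= |v| A], valid for a complex left eigenvector [v] of
    eigenvalue [z], with the positive vector [x] gives [|z| <= l]. *)
Lemma spectral_radius_perron n (A : 'M[R]_n) (x : 'cV[R]_n) l (i0 : 'I_n) :
  (forall i j, 0 < A i j) -> positive_vec x -> A *m x = l *: x ->
  spectral_radius A = l.
Proof.
move=> A0 x0 Ax; rewrite /spectral_radius; set S := (X in sup X).
have l0 : 0 < l.
  by have := mulmx_gt0 A0 x0 i0; rewrite Ax mxE pmulr_lgt0.
have S_l : S l.
  exists (real_complex R l); last by rewrite normc_real gtr0_norm.
  rewrite /= eigenvalue_map; apply: right_eigenvalue Ax.
  by apply/eqP => xE; have := x0 i0; rewrite xE mxE ltxx.
have ub_l : ubound S l.
  move=> _ [z /eigenvalueP[v vA v_neq0] <-].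
  pose u i := normc (v 0 i).
  have le_u j : normc z * u j <= \sum_i u i * A i j.
    have -> : normc z * u j = normc ((z *: v) 0 j) by rewrite mxE normcM.
    rewrite -vA mxE; apply: le_trans (normc_sum _) _.
    by apply: ler_sum => i _; rewrite mxE normcM normc_real gtr0_norm.
  have [k vk] : exists k, v 0 k != 0.
    by apply/rV0Pn.
  have u_gt0 : 0 < \sum_j u j * x j 0.
    rewrite (bigD1 k) //= ltr_pwDl //.
      rewrite mulr_gt0 // lt_neqAle normc_ge0 andbT eq_sym.
      by apply: contra vk => /eqP/eq0_normc ->.
    by apply: sumr_ge0 => j _; rewrite mulr_ge0 ?normc_ge0 // ltW.
  rewrite -(ler_pM2r u_gt0) mulr_sumr.
  have -> : l * (\sum_i u i * x i 0) = \sum_i u i * (A *m x) i 0.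
    by rewrite mulr_sumr; apply: eq_bigr => i _; rewrite Ax mxE mulrCA.
  have -> : \sum_i u i * (A *m x) i 0 =
            \sum_j (\sum_i u i * A i j) * x j 0.
    under eq_bigr do rewrite mxE mulr_sumr.
    rewrite exchange_big; apply: eq_bigr => j _ /=; rewrite mulr_suml.
    by apply: eq_bigr => i _; rewrite mulrA.
  by apply: ler_sum => j _; rewrite mulrA ler_wpM2r // ltW.
apply/le_anti/andP; split.
  by apply: ge_sup => //; exists l.
by apply: ub_le_sup => //; exists l.
Qed.

Lemma diag_mulmxE n (a : 'cV[R]_n) (B : 'M[R]_n) i j :
  (diag a *m B) i j = a i 0 * B i j.
Proof. by rewrite /diag mul_diag_mx !mxE. Qed.

Lemma diag_mulmx_colE n (a : 'cV[R]_n) (B : 'M[R]_n) (x : 'cV[R]_n) i :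
  (diag a *m B *m x) i 0 = a i 0 * (B *m x) i 0.
Proof. by rewrite -mulmxA /diag mul_diag_mx !mxE. Qed.

(** * Solutions of the Perron conditions and feasible vectors *)

Section Optimum.
Variables (n : nat) (B : 'M[R]_n) (w : 'cV[R]_n).
Hypothesis B_gt0 : forall i j, 0 < B i j.
Hypotheses (w_gt0 : positive_vec w) (w_prob : probability_vec w).

Let w_sum1 : \sum_i w i 0 = 1. Proof. by case: w_prob. Qed.
Let i0 : 'I_n. Proof. exact: sum1_inhabitant w_sum1. Qed.

Lemma gain_gt0 x : positive_vec x -> positive_vec (gain B x).
Proof. by move=> x0 i; rewrite mxE divr_gt0 //; exact: mulmx_gt0. Qed.

Lemma diag_mulmx_gt0 (a : 'cV[R]_n) : positive_vec a ->
  forall i j, 0 < (diag a *m B) i j.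
Proof. by move=> a0 i j; rewrite diag_mulmxE mulr_gt0. Qed.

Lemma gain_fix x : positive_vec x -> diag (gain B x) *m B *m x = x.
Proof.
move=> x0; apply/matrixP => i j; rewrite (ord1 j) diag_mulmx_colE mxE divfK //.
by rewrite gt_eqF //; exact: mulmx_gt0.
Qed.

Definition perron_solution (a : 'cV[R]_n) :=
  [/\ positive_vec a, spectral_radius (diag a *m B) = 1
    & perron_product (diag a *m B) w].

(** The left Perron vector is the entrywise quotient [w / x]: stationarity is
    the equation [y^T A = y^T] for it. *)
Lemma gain_perron_solution x : stationary B w x -> perron_solution (gain B x).
Proof.
move=> [x0 xS]; have Ax := gain_fix x0.
have rho1 : spectral_radius (diag (gain B x) *m B) = 1.
  apply: (spectral_radius_perron i0 (diag_mulmx_gt0 (gain_gt0 x0)) x0).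
  by rewrite scale1r.
split=> //; first exact: gain_gt0.
have xyE : entrywise_mul x (\col_i (w i 0 / x i 0)) = w.
  apply/matrixP => i j; rewrite (ord1 j) mxE mulrC mxE divfK //.
  by rewrite gt_eqF.
exists x, (\col_i (w i 0 / x i 0)); rewrite xyE; split=> //.
  by split=> //; rewrite rho1 scale1r.
split=> [i|]; first by rewrite mxE divr_gt0.
rewrite rho1 scale1r; apply/matrixP => i j; rewrite (ord1 i) [LHS]mxE.
rewrite [RHS]mxE [RHS]mxE -(xS j) mulrAC divff ?gt_eqF // mul1r mxE.
apply: eq_bigr => k _; rewrite !diag_mulmxE 2!mxE [gain _ _ _ _]mxE.
by rewrite [RHS]mulrAC !mulrA divfK // gt_eqF.
Qed.

Lemma perron_solution_gain a : perron_solution a ->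
  exists2 x, stationary B w x & a = gain B x.
Proof.
move=> [a0 rho1 [x [y [[x0]]]]]; rewrite rho1 scale1r => Ax [y0].
rewrite rho1 scale1r => yA _ xyE.
have xE i : x i 0 = a i 0 * (B *m x) i 0 by rewrite -diag_mulmx_colE Ax.
have aE : a = gain B x.
  apply/matrixP => i j; rewrite (ord1 j) mxE {1}xE mulfK //.
  by rewrite gt_eqF //; exact: mulmx_gt0.
exists x => //; split=> // j; rewrite -[w in RHS]xyE [RHS]mxE; congr (_ * _).
have -> : y j 0 = (y^T *m (diag a *m B)) 0 j by rewrite yA mxE.
rewrite [LHS]mxE [RHS]mxE; apply: eq_bigr => i _.
rewrite diag_mulmxE [y^T 0 i]mxE -xyE [entrywise_mul x y i 0]mxE xE.
by have := lt0r_neq0 (mulmx_gt0 B_gt0 x0 i) => Bx_neq0; field.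
Qed.

Lemma feasible_le_gain a : feasible B a -> exists2 x, positive_vec x &
  log_objective w a <= log_objective w (gain B x).
Proof.
move=> [a0]; have A0 := diag_mulmx_gt0 a0.
have [x x0 [l Ax]] := exists_perron A0.
rewrite (spectral_radius_perron i0 A0 x0 Ax) => l1; exists x => //.
apply: ler_sum => i _; rewrite ler_pM2l // ler_ln ?posrE //.
  2: exact: gain_gt0.
rewrite [gain _ _ _ _]mxE ler_pdivlMr; last exact: mulmx_gt0.
by rewrite -diag_mulmx_colE Ax mxE ger_pMl.
Qed.

End Optimum.
End PerronProducts.

Lemma Ftilde_gt0 (R : realType) (n : nat) (F : 'M[R]_n) (v pbar : 'cV[R]_n) :
  (forall i, F i i = 0) -> (forall i j, i != j -> 0 < F i j) ->
  positive_vec v -> positive_vec pbar ->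
  forall i j, 0 < Ftilde F v pbar i j.
Proof.
move=> F0 Foff v0 p0 i j; rewrite !mxE; have [<-|ij] := eqVneq i j.
  by rewrite F0 add0r mulr1n divr_gt0.
by rewrite mulr0n addr0 Foff.
Qed.

Theorem theorem4p5 (R : realType) (L : nat) (F : 'M[R]_L)
    (v pbar w : 'cV[R]_L)
    (F_diag : forall i, F i i = 0)
    (F_offdiag : forall i j, i != j -> 0 < F i j)
    (v_gt0 : positive_vec v) (pbar_gt0 : positive_vec pbar)
    (w_gt0 : positive_vec w) (w_prob : probability_vec w) :
  exists gamma_star : 'cV[R]_L,
    unique (fun gamma : 'cV[R]_L =>
        let A := diag gamma *m Ftilde F v pbar in
        [/\ positive_vec gamma, spectral_radius A = 1
          & perron_product A w]) gamma_star
    /\ is_maximum [set log_objective w gamma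
                    | gamma in feasible (Ftilde F v pbar)]
         (log_objective w gamma_star).
Proof.
have B0 := Ftilde_gt0 F_diag F_offdiag v_gt0 pbar_gt0.
have w1 : \sum_i w i 0 = 1 by case: w_prob.
have [x xS] := exists_stationary B0 w_gt0 w1.
have sol := gain_perron_solution B0 w_gt0 w_prob xS.
exists (gain (Ftilde F v pbar) x); split.
  split; first exact: sol.
  move=> a /(perron_solution_gain B0)[z zS ->].
  have [[x0 _] [z0 _]] := (xS, zS).
  apply: (stationary_max_eq B0 w_gt0 zS x0).
  by apply/le_anti; rewrite (stationary_max B0 w_gt0 zS x0);
    exact: (stationary_max B0 w_gt0 xS z0).
split.
  exists (gain (Ftilde F v pbar) x) => //.
  by case: sol => a0 rho1 _; split=> //; rewrite rho1.
move=> _ [a /(feasible_le_gain B0 w_gt0 w_prob)[z z0 le_az] <-].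
by apply: le_trans le_az _; exact: stationary_max.
Qed.
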